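(* Let $G$ be a connected graph of order $n\ge 3$ and let $H$ be a non-trivial graph. The following are equivalent: (i) no adjacency basis for $H$ is a dominating set of $H$; (ii) $\operatorname{dim}_A(G\odot H)=n\cdot \operatorname{dim}_A(H)+n-1$; (iii) $\operatorname{dim}_A(G\odot H)=\operatorname{dim}(G\odot H)+n-1$.
   Context: All graphs are finite, simple, undirected; non-trivial means order at least 2. For a connected graph, $d$ is shortest-path distance; a metric generator is a vertex set $S$ such that every two distinct vertices $x,y$ satisfy $d(s,x)\ne d(s,y)$ for some $s\in S$; $\operatorname{dim}$ is the minimum size of a metric generator. A set $S\subseteq V(H)$ is an adjacency generator for $H$ if for every two distinct $x,y\in V(H)\setminus S$ there exists $s\in S$ with $|N_H(s)\cap\{x,y\}|=1$ ($N_H$ the open neighbourhood); an adjacency basis is an adjacency generator of minimum cardinality, and this cardinality is $\operatorname{dim}_A(H)$. A dominating set $D$ satisfies $\bigcup_{v\in D}N_H[v]=V(H)$. The corona product $G\odot H$ ($G$ of order $n$ with vertices $v_1,\dots,v_n$) consists of $G$ and $n$ disjoint copies $H_1,\dots,H_n$ of $H$, with $v_i$ joined to every vertex of $H_i$. *)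

(* Defs.v *)
From mathcomp Require Import all_boot.

Set Implicit Arguments.
Unset Strict Implicit.
Unset Printing Implicit Defensive.

Record sgraph := SGraph {
  svertex :> finType;
  sedge : rel svertex;
  sedge_sym : symmetric sedge;
  sedge_irr : irreflexive sedge }.

Section GraphNotions.
Variable G : sgraph.
Implicit Types (x y s : G) (S D : {set G}).

Definition open_nbh x : {set G} := [set y | sedge x y].

Definition closed_nbh x : {set G} := x |: open_nbh x.

(* Nonemptiness is not included. *)
Definition connected_graph : Prop := forall x y, connect (@sedge G) x y.

Definition walk_of_length x y k : bool :=
  [exists p : k.-tuple G, path (@sedge G) x p && (last x p == y)].

(* Shortest paths have length less than the order of the graph, so the search
   can stop there; for x and y in different components the value is #|G|. *)
Definition dist x y : nat := find (walk_of_length x y) (iota 0 #|G|).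

Lemma dist_spec x y : connect (@sedge G) x y ->
  walk_of_length x y (dist x y) /\
  forall k, walk_of_length x y k -> dist x y <= k.
Proof.
case/connectP=> p xp ->; case/shortenP: xp => q xq Uq _.
have wq : walk_of_length x (last x q) (size q).
  by apply/existsP; exists (in_tuple q); rewrite xq eqxx.
have ltq : size q < #|G| by move/card_uniqP: Uq => /= <-; apply: max_card.
have ltd : dist x (last x q) < #|G|.
  rewrite -[X in _ < X](size_iota 0) -has_find; apply/hasP.
  by exists (size q); rewrite // mem_iota.
split=> [|k wk].
  have := nth_find 0 (a := walk_of_length x (last x q)) (s := iota 0 #|G|).
  by rewrite nth_iota //; apply; rewrite has_find size_iota.
rewrite leqNgt; apply/negP => ltk.
by have := before_find 0 ltk; rewrite nth_iota ?(ltn_trans ltk) // wk.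
Qed.

Definition metric_generator S : bool :=
  [forall x, forall y, (x != y) ==> [exists s in S, dist s x != dist s y]].

Definition metric_dim : nat :=
  #|[arg min_(S < [set: G] | metric_generator S) #|S| ]|.

Definition adjacency_generator S : bool :=
  [forall x in ~: S, forall y in ~: S, (x != y) ==>
     [exists s in S, #|open_nbh s :&: [set x; y]| == 1]].

Definition adjacency_dim : nat :=
  #|[arg min_(S < [set: G] | adjacency_generator S) #|S| ]|.

Definition adjacency_basis S : bool :=
  adjacency_generator S && (#|S| == adjacency_dim).

Definition dominating_set D : bool :=
  \bigcup_(v in D) closed_nbh v == [set: G].

(* The vertex set [set: G] is a valid starting point for both minima above. *)
Lemma metric_generatorT : metric_generator [set: G].
Proof.
apply/forallP => x; apply/forallP => y; apply/implyP => xy.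
have G0 : 0 < #|G| by apply/card_gt0P; exists x.
have walk0 z : walk_of_length x z 0 = (x == z).
  apply/existsP/eqP => [[p]|->]; first by rewrite tuple0 => /eqP.
  by exists [tuple]; rewrite /= eqxx.
apply/existsP; exists x; rewrite inE /dist.
by case: #|G| G0 => //= n _; rewrite !walk0 eqxx (negPf xy).
Qed.

Lemma adjacency_generatorT : adjacency_generator [set: G].
Proof. by apply/forallP => x; rewrite !inE. Qed.

End GraphNotions.

Section Corona.
Variables G H : sgraph.

(* [inl v] is the vertex v of G; [inr (v, x)] is the vertex x of the copy of H
   attached to v. *)
Definition corona_rel : rel (G + G * H)%type := fun a b =>
  match a, b with
  | inl u, inl v => sedge u v
  | inl u, inr (v, _) => u == v
  | inr (u, _), inl v => u == v
  | inr (u, x), inr (v, y) => (u == v) && sedge x y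
  end.

Fact corona_sym : symmetric corona_rel.
Proof.
move=> [u|[u x]] [v|[v y]] //=; first exact: sedge_sym.
by rewrite eq_sym sedge_sym.
Qed.

Fact corona_irr : irreflexive corona_rel.
Proof. by move=> [u|[u x]] /=; rewrite ?eqxx sedge_irr. Qed.

Definition corona : sgraph := SGraph corona_sym corona_irr.

End Corona.

(* Main.v *)
(* Write a for adjacency_dim H. A vertex of the corona outside the copy H_i has
   the same distance, and the same adjacency, to all of H_i; hence every metric
   or adjacency generator S meets each H_i in an adjacency generator of H.
   Conversely a copy of an adjacency basis in each H_i is a metric generator, so
   the metric dimension of the corona is n a and (ii) and (iii) say the same.
   For (i) <-> (ii), when no basis of H dominates, an i with v_i outside S and
   |S :&: H_i| = a leaves some vertex of H_i undominated by S; two such vertices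
   would not be distinguished, so all i but one contribute at least a + 1.
   If a basis B dominates H, the copies of B together with all vertices of G
   but two neighbours of a common vertex form a generator of order
   n a + n - 2. *)

Require Import Defs.
From mathcomp Require Import all_boot.
From mathcomp Require Import zify.

Set Implicit Arguments.
Unset Strict Implicit.
Unset Printing Implicit Defensive.

(** * Walks, distances, generators and dominating sets in a single graph *)

Section Graph.
Variable G : sgraph.
Implicit Types (x y z s : G) (S : {set G}).

Lemma walkP x y k :
  reflect (exists p, [/\ path (@sedge G) x p, last x p = y & size p = k])
          (walk_of_length x y k).
Proof.
apply: (iffP existsP) => [[p /andP[xp /eqP <-]]|[p [xp <- <-]]].
  by exists p; rewrite size_tuple.
by exists (in_tuple p); rewrite xp eqxx.
Qed.

Lemma walk0 x y : walk_of_length x y 0 = (x == y).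
Proof.
apply/walkP/eqP => [[p [_ <- /size0nil ->]] //|->]; first by exists [::].
Qed.

Lemma walkSP x y k :
  reflect (exists2 z, walk_of_length x z k & sedge z y)
          (walk_of_length x y k.+1).
Proof.
apply: (iffP (walkP _ _ _)) => [[p]|[z /walkP[p [xp <- <-]] zy]].
  case/lastP: p => [[]//|p z] [].
  rewrite rcons_path last_rcons size_rcons => /andP[xp pz] <- [szp].
  by exists (last x p) => //; apply/walkP; exists p.
by exists (rcons p y); rewrite rcons_path xp zy last_rcons size_rcons.
Qed.

Lemma walk_connect x y k : walk_of_length x y k -> connect (@sedge G) x y.
Proof. by case/walkP=> p [xp <- _]; apply/connectP; exists p. Qed.

Lemma distxx x : dist x x = 0.
Proof.
have [_ /(_ 0)] := dist_spec (connect0 (@sedge G) x).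
by rewrite walk0 eqxx leqn0 => /(_ isT)/eqP.
Qed.

Lemma dist_edge s x y : connected_graph G -> sedge x y ->
  dist s y <= (dist s x).+1.
Proof.
move=> Gconn xy; have [wx _] := dist_spec (Gconn s x).
have [_ -> //] := dist_spec (Gconn s y).
by apply/walkSP; exists x.
Qed.

(** [z] is the last vertex but one of a shortest walk from [s] to [x]. *)
Lemma dist_pred s x : connected_graph G -> x != s ->
  exists2 z, sedge z x & dist s x = (dist s z).+1.
Proof.
move=> Gconn xs; have [wx _] := dist_spec (Gconn s x).
case def_d: (dist s x) wx => [|d]; first by rewrite walk0 eq_sym (negPf xs).
case/walkSP=> z wz zx; exists z => //; apply/eqP.
rewrite eqn_leq -{1}def_d dist_edge //= ltnS.
by have [_ ->] := dist_spec (Gconn s z).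
Qed.

(** Stepping back through predecessors yields a walk of length [f x], and the edge condition makes
    every walk from [s] to [x] at least that long. This reduces the distance formulas in the corona
    to local checks. *)
Lemma dist_unique (f : G -> nat) s :
    f s = 0 ->
    (forall x y, sedge x y -> f y <= (f x).+1) ->
    (forall x, x != s -> exists2 z, sedge z x & f x = (f z).+1) ->
  forall x, dist s x = f x.
Proof.
move=> fs f_edge f_pred.
have walk_f k x : f x = k -> walk_of_length s x k.
  elim: k x => [|k IHk] x fx; have [xs|/f_pred[z zx]] := eqVneq x s.
  - by rewrite walk0 xs.
  - by rewrite fx.
  - by rewrite xs fs in fx.
  by rewrite fx => -[fz]; apply/walkSP; exists z; rewrite ?IHk.
have f_walk k x : walk_of_length s x k -> f x <= k.
  elim: k x => [|k IHk] x; first by rewrite walk0 => /eqP <-; rewrite fs.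
  by case/walkSP=> z /IHk fz /f_edge/leq_trans->.
move=> x; have wx := walk_f _ _ (erefl (f x)).
have [wd dmin] := dist_spec (walk_connect wx).
by apply/eqP; rewrite eqn_leq dmin // f_walk.
Qed.

Lemma card_nbh_pair s x y : x != y ->
  (#|open_nbh s :&: [set x; y]| == 1) = (sedge s x != sedge s y).
Proof.
move=> xy; rewrite setIUr cardsU setIACA setIid.
have -> : [set x] :&: [set y] = set0.
  by apply/setP=> z; rewrite !inE; case: eqP => // ->; rewrite (negPf xy).
rewrite setI0 cards0 subn0.
have card1 z : #|open_nbh s :&: [set z]| = sedge s z.
  case sz: (sedge s z).
    by rewrite (setIidPr _) ?cards1 // sub1set inE.
  by apply/eqP; rewrite cards_eq0 setI_eq0 disjoint_sym disjoints1 inE sz.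
by rewrite !card1; do 2!case: (sedge s _).
Qed.

Lemma adjacency_generatorP S :
  reflect (forall x y, x \notin S -> y \notin S -> x != y ->
             exists2 s, s \in S & sedge s x != sedge s y)
          (adjacency_generator S).
Proof.
apply: (iffP idP) => [/forall_inP genS x y xS yS xy | genS].
  have /forall_inP genSx := genS x (etrans (in_setC _ _) xS).
  have /implyP/(_ xy) := genSx y (etrans (in_setC _ _) yS).
  by case/exists_inP=> s sS; rewrite card_nbh_pair //; exists s.
apply/forall_inP=> x xS; apply/forall_inP=> y yS; apply/implyP=> xy.
rewrite !inE in xS yS; have [s sS sxy] := genS x y xS yS xy.
by apply/exists_inP; exists s; rewrite // card_nbh_pair.
Qed.

Lemma metric_generatorP S :
  reflect (forall x y, x != y -> exists2 s, s \in S & dist s x != dist s y)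
          (metric_generator S).
Proof.
apply: (iffP idP) => [/forallP genS x y xy | genS].
  by have /forallP/(_ y)/implyP/(_ xy)/exists_inP := genS x.
apply/forallP=> x; apply/forallP=> y; apply/implyP=> xy.
exact/exists_inP/genS.
Qed.

Lemma dominating_setP S :
  reflect (forall x, x \notin S -> exists2 s, s \in S & sedge s x)
          (dominating_set S).
Proof.
apply: (iffP eqP) => [domS x xS | domS].
  have /bigcupP[s sS] : x \in \bigcup_(v in S) closed_nbh v.
    by rewrite domS inE.
  rewrite !inE => /predU1P[xs|]; last by exists s.
  by rewrite xs sS in xS.
apply/setP=> x; rewrite inE; apply/bigcupP.
have [xS|/domS[s sS sx]] := boolP (x \in S).
  by exists x; rewrite // !inE eqxx.
by exists s; rewrite // !inE sx orbT.
Qed.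

Lemma adjacency_dim_le S : adjacency_generator S -> adjacency_dim G <= #|S|.
Proof.
move=> genS; rewrite /adjacency_dim.
by case: arg_minnP => [|A _]; [apply: adjacency_generatorT | apply].
Qed.

Lemma adjacency_basis_exists : exists S, adjacency_basis S.
Proof.
rewrite /adjacency_basis /adjacency_dim.
case: arg_minnP => [|A genA _]; first exact: adjacency_generatorT.
by exists A; rewrite genA eqxx.
Qed.

Lemma metric_dim_le S : metric_generator S -> metric_dim G <= #|S|.
Proof.
move=> genS; rewrite /metric_dim.
by case: arg_minnP => [|A _]; [apply: metric_generatorT | apply].
Qed.

Lemma metric_dim_attained :
  exists2 S : {set G}, metric_generator S & #|S| = metric_dim G.
Proof.
rewrite /metric_dim; case: arg_minnP => [|A genA _].
  exact: metric_generatorT.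
by exists A.
Qed.

Lemma adjacency_generator_neq0 S :
  2 <= #|G| -> adjacency_generator S -> exists x, x \in S.
Proof.
case/card_gt1P=> x [y [_ _ xy]] /adjacency_generatorP genS; apply/set0Pn.
apply: contraTneq isT => S0; rewrite S0 in genS.
by have [||s] := genS x y _ _ xy; rewrite inE.
Qed.

Lemma connected_neighbour x : connected_graph G -> 2 <= #|G| ->
  exists y : G, sedge x y.
Proof.
move=> Gconn; rewrite ltnNge => /negP G2; apply/existsP.
apply: contra_notT G2 => /existsPn xiso; apply/card_le1P=> y _ z.
have iso w : w = x.
  by have /connectP[[|v p] //= /andP[]] := Gconn x w; rewrite (negPf (xiso v)).
by rewrite !inE (iso y) (iso z) eqxx.
Qed.

(** If no vertex had two distinct neighbours, the two ends of any edge would form a set closed under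
    adjacency, and connectedness would leave no room for a third vertex. *)
Lemma connected_degree2 : connected_graph G -> 3 <= #|G| ->
  exists c p q : G, [/\ p != q, sedge c p & sedge c q].
Proof.
move=> Gconn G3; have [x0 _] : exists x, x \in G.
  by apply/card_gt0P; apply: leq_trans G3.
have [y0 xy] := connected_neighbour x0 Gconn (ltnW G3).
have [z] : exists z, z \notin [set x0; y0].
  apply/existsP; rewrite -negb_forall; apply: contraL G3 => /forallP sub.
  rewrite -leqNgt (leq_trans _ (_ : #|[set x0; y0]| <= 2)) //.
    by apply/subset_leq_card/subsetP=> z _; apply: sub.
  by rewrite cards2; case: eqP.
have [/existsP[c /existsP[p /existsP[q /and3P[]]]]|no] :=
  boolP [exists c, exists p, exists q, [&& p != q, @sedge G c p & sedge c q]].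
  by exists c, p, q.
have deg1 (c p q : G) : sedge c p -> sedge c q -> p = q.
  move=> cp cq; apply: contraNeq no => pq.
  by apply/existsP; exists c; apply/existsP; exists p; apply/existsP; exists q;
    rewrite pq cp.
have cl : closed (@sedge G) [set x0; y0].
  apply: intro_closed => [u v|u v uv]; first exact/sym_connect_sym/sedge_sym.
  rewrite !inE => /orP[]/eqP def_u; subst u.
    by rewrite (deg1 _ _ _ uv xy) eqxx orbT.
  by rewrite sedge_sym in xy; rewrite (deg1 _ _ _ uv xy) eqxx.
by rewrite -(closed_connect cl (Gconn x0 z)) !inE eqxx.
Qed.

End Graph.

(** If some [w i] equals [a], the other terms are at least [a.+1] and the bound is the sum of these
    minima; if none does, every term is at least [a.+1]. *)
Lemma leq_sum_but_one (I : finType) (w : I -> nat) a :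
    (forall i, a <= w i) ->
    (forall i j, i != j -> w i = a -> a < w j) ->
  #|I| * a + #|I| - 1 <= \sum_i w i.
Proof.
move=> w_ge w_gt; have [/existsP[i /eqP wi]|/existsPn no] :=
    boolP [exists i, w i == a].
  rewrite (bigD1 i) //= wi.
  have : \sum_(j | j != i) a.+1 <= \sum_(j | j != i) w j.
    by apply: leq_sum => j ji; apply: w_gt wi; rewrite eq_sym.
  have -> : \sum_(j | j != i) a.+1 = #|I|.-1 * a.+1.
    by rewrite sum_nat_const cardC1.
  have : 0 < #|I| by apply/card_gt0P; exists i.
  case: #|I| => // k _ /=; rewrite mulnS mulSn; lia.
have : \sum_(j : I) a.+1 <= \sum_j w j.
  by apply: leq_sum => j _; rewrite ltn_neqAle eq_sym no w_ge.
by rewrite sum_nat_const -[#|_|]/#|I| mulnS; lia.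
Qed.

(** * Vertex sets of the corona and their traces on the copies *)

Section Corona.
Variables G H : sgraph.
Local Notation C := (corona G H).

Definition fibre (S : {set C}) (i : G) : {set H} :=
  [set x | (inr (i, x) : C) \in S].

Definition corona_set (D : {set G}) (B : {set H}) : {set C} :=
  [set a : C | match a with inl v => v \in D | inr (_, x) => x \in B end].

Lemma card_corona (S : {set C}) :
  #|S| = \sum_i (((inl i : C) \in S) + #|fibre S i|).
Proof.
rewrite -sum1_card big_mkcond big_sumType /= big_split /=.
congr (_ + _).
transitivity (\sum_i \sum_x (if (inr (i, x) : C) \in S then 1 else 0)).
  by rewrite pair_bigA; apply: eq_bigr => -[].
apply: eq_bigr => i _; rewrite -sum1_card [RHS]big_mkcond.
by apply: eq_bigr => x _; rewrite inE.
Qed.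

Lemma card_corona_set D B : #|corona_set D B| = #|D| + #|G| * #|B|.
Proof.
rewrite card_corona big_split /= -sum_nat_const; congr (_ + _).
  rewrite -sum1_card [RHS]big_mkcond; apply: eq_bigr => i _.
  by rewrite inE; case: (i \in D).
by apply: eq_bigr => i _; apply: eq_card => x; rewrite !inE.
Qed.

Lemma fibre_adjacency_generator (S : {set C}) i :
  adjacency_generator S -> adjacency_generator (fibre S i).
Proof.
move=> /adjacency_generatorP genS; apply/adjacency_generatorP => x y.
rewrite !inE => xS yS xy.
have [|[u|[u z]] sS /=] := genS (inr (i, x)) (inr (i, y)) xS yS.
- by apply: contraNneq xy => -[->].
- by rewrite eqxx.
have [eq_ui|] := eqVneq u i; last by rewrite eqxx.
by exists z; rewrite // inE -eq_ui.
Qed.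

(** * Distances in the corona *)

Section Connected.
Hypothesis Gconn : connected_graph G.

Lemma dist_corona_base u (a : C) :
  dist (inl u : C) a =
  match a with inl v => dist u v | inr (v, _) => (dist u v).+1 end.
Proof.
move: a; apply: dist_unique => [|[v|[v x]] [w|[w y]]|[v|[v x]]] /=.
- exact: distxx.
- exact: dist_edge.
- by move/eqP->.
- by move/eqP->; do 2!apply: leqW.
- by case/andP=> /eqP->.
- move=> vu; have {}vu : v != u by apply: contraNneq vu => ->.
  by have [w wv ->] := dist_pred Gconn vu; exists (inl w).
by exists (inl v) => //=.
Qed.

(** Inside the copy over [u], distances never exceed 2 because [u] is a common neighbour; every path
    to another copy leaves through [u] and enters through [v], which costs two extra steps. *)
Lemma dist_corona_copy u z (a : C) :
  dist (inr (u, z) : C) a =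
  match a with
  | inl v => (dist u v).+1
  | inr (v, x) => if v != u then (dist u v).+2
                  else if x == z then 0 else if sedge z x then 1 else 2
  end.
Proof.
move: a; apply: dist_unique => [|[v|[v x]] [w|[w y]]|[v|[v x]]] /=.
- by rewrite !eqxx.
- exact: dist_edge.
- move/eqP->; have [->|//] := eqVneq w u.
  by case: eqP => // _; case: ifP.
- move/eqP->; have [->|_] := eqVneq w u; first by rewrite distxx.
  by do 2!apply: leqW.
- case/andP=> /eqP-> xy; have [_|//] := eqVneq w u.
  have [eq_yz|] := eqVneq y z => //=; have [<-|] := eqVneq x z.
    by rewrite xy.
  by do 2!case: ifP.
- move=> _; have [->|vu] := eqVneq v u.
    exists (inr (u, z)) => /=; first by rewrite eqxx.
    by rewrite !eqxx distxx.
  have [w wv ->] := dist_pred Gconn vu.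
  by exists (inl w).
have [-> xz|vu _] := eqVneq v u; last by exists (inl v) => /=.
rewrite /=; have [eq_xz|_] := eqVneq x z; first by rewrite eq_xz eqxx in xz.
case: ifP => zx; first by exists (inr (u, z)); rewrite /= !eqxx ?zx.
by exists (inl u); rewrite /= ?eqxx ?distxx.
Qed.

(** * Metric dimension of the corona *)

Lemma fibre_metric_generator (S : {set C}) i :
  metric_generator S -> adjacency_generator (fibre S i).
Proof.
move=> /metric_generatorP genS; apply/adjacency_generatorP => x y.
rewrite !inE => xS yS xy.
have [|[u|[u z]] sS] := genS (inr (i, x)) (inr (i, y)).
- by apply: contraNneq xy => -[->].
- by rewrite !dist_corona_base eqxx.
rewrite !dist_corona_copy.
have [eq_iu|] := eqVneq i u; last by rewrite eqxx.
subst u => dxy; exists z; first by rewrite inE.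
(* Since [z] differs from [x] and [y], both distances are 1 or 2, and they differ exactly when the
   adjacencies to [z] do. *)
move: dxy; have [eq_xz|_] := eqVneq x z; first by rewrite eq_xz sS in xS.
have [eq_yz|_] := eqVneq y z; first by rewrite eq_yz sS in yS.
by do 2!case: (sedge z _).
Qed.

Lemma corona_set0_metric_generator (B : {set H}) :
  2 <= #|G| -> 2 <= #|H| -> adjacency_generator B ->
  metric_generator (corona_set set0 B).
Proof.
move=> G2 H2 genB; have [b bB] := adjacency_generator_neq0 H2 genB.
have inS i z : z \in B -> (inr (i, z) : C) \in corona_set set0 B.
  by rewrite inE.
have distP (u v : G) : u != v -> 0 < dist u v.
  by rewrite eq_sym => vu; have [? _ ->] := dist_pred Gconn vu.
apply/metric_generatorP=> -[v|[v x]] [w|[w y]] /= xy.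
- have vw : v != w by apply: contraNneq xy => ->.
  exists (inr (v, b)); rewrite ?inS // !dist_corona_copy distxx.
  by rewrite neq_ltn !ltnS distP.
- have [<-{w xy}|vw] := eqVneq v w.
    (* The copy over [v] itself may fail here, since [b] can be adjacent to [y] and then has
       distance 1 to both vertices. Seen from the copy over another vertex [u], the copy over [v] is
       one step further away than [v]. *)
    have [u uv] := connected_neighbour v Gconn G2.
    have vu : v != u by apply: contraTneq uv => ->; rewrite sedge_irr.
    exists (inr (u, b)); rewrite ?inS // !dist_corona_copy vu.
    by rewrite neq_ltn leqnn.
  exists (inr (v, b)); rewrite ?inS // !dist_corona_copy distxx.
  by rewrite [w == v]eq_sym vw neq_ltn.
- have [<-{w xy}|vw] := eqVneq v w.
    have [u uv] := connected_neighbour v Gconn G2.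
    have vu : v != u by apply: contraTneq uv => ->; rewrite sedge_irr.
    exists (inr (u, b)); rewrite ?inS // !dist_corona_copy vu.
    by rewrite neq_ltn leqnn orbT.
  exists (inr (w, b)); rewrite ?inS // !dist_corona_copy distxx.
  by rewrite vw neq_ltn orbT.
have [eq_vw|vw] := eqVneq v w; last first.
  (* From [b] in the copy over [v], that copy lies within distance 2, and the copy over [w] at
     distance at least 3. *)
  exists (inr (v, b)); rewrite ?inS // !dist_corona_copy eqxx [w == v]eq_sym vw /=.
  by have := distP _ _ vw; case: (x == b) => //; case: sedge; case: (dist v w).
subst w; have {}xy : x != y by apply: contraNneq xy => ->.
have self z t : z \in B -> z != t ->
    dist (inr (v, z) : C) (inr (v, z)) != dist (inr (v, z) : C) (inr (v, t)).
  rewrite !dist_corona_copy !eqxx [t == z]eq_sym /= => _ /negPf->.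
  by case: ifP.
have [xB|xB] := boolP (x \in B).
  by exists (inr (v, x)); rewrite ?inS ?self.
have [yB|yB] := boolP (y \in B).
  by exists (inr (v, y)); rewrite ?inS // eq_sym self // eq_sym.
have [s sB sxy] := adjacency_generatorP _ genB _ _ xB yB xy.
exists (inr (v, s)); rewrite ?inS // !dist_corona_copy eqxx /=.
have [eq_xs|_] := eqVneq x s; first by rewrite eq_xs sB in xB.
have [eq_ys|_] := eqVneq y s; first by rewrite eq_ys sB in yB.
by move: sxy; do 2!case: (sedge s _).
Qed.

Lemma metric_dim_corona : 2 <= #|G| -> 2 <= #|H| ->
  metric_dim C = #|G| * adjacency_dim H.
Proof.
move=> G2 H2; apply/eqP; rewrite eqn_leq; apply/andP; split.
  have [B /andP[genB /eqP <-]] := adjacency_basis_exists H.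
  have := metric_dim_le (corona_set0_metric_generator G2 H2 genB).
  by rewrite card_corona_set cards0.
have [S genS <-] := metric_dim_attained C.
rewrite card_corona -sum_nat_const leq_sum // => i _.
by rewrite (leq_trans (adjacency_dim_le (fibre_metric_generator i genS))) ?leq_addl.
Qed.

(** * Adjacency dimension of the corona *)

(* The vertices of G outside D and the copies attached to them are told apart
   either because B dominates H or because only one such copy exists. *)
Lemma corona_set_adjacency_generator (D : {set G}) (B : {set H}) :
    2 <= #|H| -> adjacency_generator B -> dominating_set D ->
    dominating_set B \/ #|~: D| <= 1 ->
  adjacency_generator (corona_set D B).
Proof.
move=> H2 genB /dominating_setP domD domB.
have [b bB] := adjacency_generator_neq0 H2 genB.
have inS i z : z \in B -> (inr (i, z) : C) \in corona_set D B.
  by rewrite inE.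
have inD i : i \in D -> (inl i : C) \in corona_set D B by rewrite inE.
(* If [w] is [v], a neighbour of [v] in [D] sees [v] but nothing of the copy over [v]; otherwise [b]
   in the copy over [v] sees [v] but nothing of the copy over [w]. *)
have base_copy v w y : v \notin D -> exists2 s : C, s \in corona_set D B
    & sedge s (inl v : C) != sedge s (inr (w, y) : C).
  move=> vD; have [<-{w}|vw] := eqVneq v w.
    have [u uD uv] := domD v vD; exists (inl u); rewrite ?inD //= uv.
    by apply: contraTneq uv => /esym/eqP->; rewrite sedge_irr.
  by exists (inr (v, b)); rewrite ?inS //= eqxx (negPf vw).
apply/adjacency_generatorP=> -[v|[v x]] [w|[w y]]; rewrite !inE => xS yS xy.
- have vw : v != w by apply: contraNneq xy => ->.
  by exists (inr (v, b)); rewrite ?inS //= eqxx (negPf vw).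
- exact: base_copy.
- by have [s sS sxy] := base_copy w v x yS; exists s; rewrite // eq_sym.
have [eq_vw|vw] := eqVneq v w; last first.
  case: domB => [/dominating_setP/(_ x xS)[s sB sx] | D1].
    by exists (inr (v, s)); rewrite ?inS //= eqxx (negPf vw) sx.
  have [vD|vD] := boolP (v \in D).
    by exists (inl v); rewrite ?inD //= eqxx (negPf vw).
  have [wD|wD] := boolP (w \in D).
    by exists (inl w); rewrite ?inD //= eqxx [w == v]eq_sym (negPf vw).
  by rewrite (card_le1_eqP D1 v w) ?eqxx ?inE in vw.
subst w; have {}xy : x != y by apply: contraNneq xy => ->.
have [s sB sxy] := adjacency_generatorP _ genB _ _ xS yS xy.
by exists (inr (v, s)); rewrite ?inS //= eqxx.
Qed.

(** Leaving out a single vertex [v] of [G] keeps a dominating set, as [v] has a neighbour; only one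
    copy then lacks its base vertex, so the basis [B] need not dominate. The [#|G| - 1] counts the
    base vertices kept. *)
Lemma adjacency_dim_corona_le : 2 <= #|G| -> 2 <= #|H| ->
  adjacency_dim C <= #|G| * adjacency_dim H + #|G| - 1.
Proof.
move=> G2 H2; have [v _] : exists v, v \in G.
  by apply/card_gt0P/ltnW.
have [B /andP[genB /eqP <-]] := adjacency_basis_exists H.
have /adjacency_dim_le : adjacency_generator (corona_set [set~ v] B).
  apply: corona_set_adjacency_generator => //.
    apply/dominating_setP=> x; rewrite !inE negbK => /eqP->.
    have [u vu] := connected_neighbour v Gconn G2.
    exists u; last by rewrite sedge_sym.
    by rewrite !inE; apply: contraTneq vu => ->; rewrite sedge_irr.
  by right; rewrite setCK cards1.
by rewrite card_corona_set cardsC1; lia.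
Qed.

(* With two neighbours of a common vertex removed, V(G) still dominates G. *)
Lemma adjacency_dim_corona_dominating (B : {set H}) :
    3 <= #|G| -> 2 <= #|H| -> adjacency_basis B -> dominating_set B ->
  adjacency_dim C < #|G| * adjacency_dim H + #|G| - 1.
Proof.
move=> G3 H2 /andP[genB /eqP <-] domB.
have [c [p [q [pq cp cq]]]] := connected_degree2 Gconn G3.
have /adjacency_dim_le : adjacency_generator (corona_set (~: [set p; q]) B).
  apply: corona_set_adjacency_generator => //; last by left.
  apply/dominating_setP=> x; rewrite !inE negbK => xpq; exists c.
    rewrite !inE negb_or; apply/andP.
    by split; [apply: contraTneq cp | apply: contraTneq cq] => ->;
      rewrite sedge_irr.
  by case/orP: xpq => /eqP->.
have := cardsC [set p; q]; rewrite card_corona_set cards2 pq; lia.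
Qed.

(* Two copies of H, each containing a vertex that S does not dominate,
   would contain two vertices that S does not distinguish. *)
Lemma adjacency_dim_corona_ge :
    (forall B : {set H}, adjacency_basis B -> ~~ dominating_set B) ->
  #|G| * adjacency_dim H + #|G| - 1 <= adjacency_dim C.
Proof.
move=> nodom; have [S /andP[genS /eqP <-]] := adjacency_basis_exists C.
have fibre_ge i := adjacency_dim_le (fibre_adjacency_generator i genS).
have undominated i : ((inl i : C) \in S) + #|fibre S i| = adjacency_dim H ->
    exists2 x, (inr (i, x) : C) \notin S
      & forall s, s \in S -> ~~ sedge s (inr (i, x) : C).
  (* The fibre alone already has at least [adjacency_dim H] elements, so equality excludes the base
     vertex and makes the fibre a basis. *)
  move=> wi; have iS : (inl i : C) \notin S.
    by apply/negP=> iS; have := fibre_ge i; rewrite -wi iS ltnn.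
  have : ~~ dominating_set (fibre S i).
    apply: nodom; rewrite /adjacency_basis fibre_adjacency_generator //.
    by rewrite -wi (negPf iS) eqxx.
  have [/existsP[x /andP[xS /forall_inP xdom]] _|/existsPn no] := boolP
      [exists x, ((inr (i, x) : C) \notin S) &&
         [forall s in S, ~~ @sedge C s (inr (i, x))]].
    by exists x.
  (* If every vertex of the copy outside [S] had a neighbour in [S], that neighbour could not be the
     base vertex, so it would lie in the same copy and the fibre would dominate [H]. *)
  case/negP; apply/dominating_setP=> x; rewrite inE => xS.
  have := no x; rewrite xS /= => /forall_inPn[[u|[u z]] sS];
    rewrite negbK /=.
    by move/eqP=> eq_ui; rewrite -eq_ui sS in iS.
  by case/andP=> /eqP eq_ui zx; exists z; rewrite // inE -eq_ui.
rewrite card_corona; apply: leq_sum_but_one => [i|i j ij wi].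
  exact: leq_trans (fibre_ge i) (leq_addl _ _).
rewrite ltn_neqAle (leq_trans (fibre_ge j)) ?leq_addl // andbT.
apply: contraNneq ij => /esym wj.
have [x xS xdom] := undominated i wi; have [y yS ydom] := undominated j wj.
apply: contraT => ij.
have [|s sS] := adjacency_generatorP _ genS _ _ xS yS.
  by apply: contraNneq ij => -[->].
by rewrite (negPf (xdom s sS)) (negPf (ydom s sS)).
Qed.

End Connected.
End Corona.

Theorem theorem16 (G H : sgraph) (n : nat) :
  connected_graph G -> #|G| = n -> 3 <= n -> 2 <= #|H| ->
  [<-> (* (i) *)
       forall B : {set H}, adjacency_basis B -> ~~ dominating_set B;
       (* (ii) *)
       adjacency_dim (corona G H) = n * adjacency_dim H + n - 1;
       (* (iii) *)
       adjacency_dim (corona G H) = metric_dim (corona G H) + n - 1].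
Proof.
move=> Gconn <- G3 H2; have G2 := ltnW G3.
(* With the metric dimension replaced by its value, (iii) reads as (ii), so the cycle leaves only
   (i) to (ii) and (iii) to (i). *)
rewrite metric_dim_corona //; tfae=> // [nodom | dimC B basisB].
  by apply/eqP; rewrite eqn_leq adjacency_dim_corona_le ?adjacency_dim_corona_ge.
apply/negP=> domB.
by have := adjacency_dim_corona_dominating Gconn G3 H2 basisB domB;
  rewrite dimC ltnn.
Qed.
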